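(* Let $w\in\{b_1,b_2,b_{1,1}\}$, let $d\in\{2,3,4\}$ be the length of $w$, let $\lambda>0$ and $f\in[-\pi,\pi)^d$. Consider the functional $$\mathcal E(x;f,w):=\sum_{j=1}^d d(f_j,x_j)^2+\lambda\, d(x;w)^2,\qquad x\in[-\pi,\pi)^d.$$ (i) If $|(\langle f,w\rangle)_{2\pi}|<\pi$, then the unique minimizer of $\mathcal E(\cdot;f,w)$ over $[-\pi,\pi)^d$ is $$\hat x=\Big(f-\frac{\lambda(\langle f,w\rangle)_{2\pi}}{1+\lambda\|w\|_2^2}\,w\Big)_{2\pi}.$$ (ii) If $|(\langle f,w\rangle)_{2\pi}|=\pi$, then $\mathcal E(\cdot;f,w)$ has the two minimizers $$\hat x=\Big(f\mp\frac{\lambda\pi}{1+\lambda\|w\|_2^2}\,w\Big)_{2\pi}.$$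
   Context: For $t\in\mathbb R$, $(t)_{2\pi}$ is the unique point of $[-\pi,\pi)$ with $t-(t)_{2\pi}\in2\pi\mathbb Z$; for vectors, $(\cdot)_{2\pi}$ is applied componentwise. Points of the circle $\mathbb S^1$ are represented by angles in $[-\pi,\pi)$ with respect to a fixed base point; for $x,y\in[-\pi,\pi)$ the geodesic distance is $d(x,y)=\min_{k\in\mathbb Z}|y-x+2\pi k|=|(y-x)_{2\pi}|$. $b_1=(-1,1)^{\mathrm T}$, $b_2=(1,-2,1)^{\mathrm T}$, $b_{1,1}=(-1,1,1,-1)^{\mathrm T}$. For $w\in\mathbb R^d\setminus\{0\}$ with $\sum_j w_j=0$ put $\Delta(x;w):=\langle x,w\rangle$. The absolute cyclic difference of $x\in[-\pi,\pi)^d$ with respect to $w$ is $$d(x;w):=\min_{\alpha\in\mathbb R}\big|\Delta([x+\alpha 1_d]_{2\pi};w)\big|,$$ where $1_d$ is the all-ones vector and $[\cdot]_{2\pi}$ is applied componentwise, with $[t]_{2\pi}=(t)_{2\pi}$ if $t\notin\{(2k+1)\pi:k\in\mathbb Z\}$ and $[(2k+1)\pi]_{2\pi}=\pm\pi$, i.e. both values are allowed, independently in each component, and the minimum is also taken over these choices. *)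

(* Defs.v *)
From HB Require Import structures.
From mathcomp Require Import all_boot all_order all_algebra.
From mathcomp Require Import boolp classical_sets reals trigo.
From mathcomp Require Import ring lra zify.

Set Implicit Arguments.
Unset Strict Implicit.
Unset Printing Implicit Defensive.

Import Order.TTheory GRing.Theory Num.Theory.
Local Open Scope classical_set_scope.
Local Open Scope ring_scope.

Section Cyclic.
Variable R : realType.
Implicit Types (s t : R) (d : nat).

(* $(t)_{2\pi}$; see [mod2pi_itv], [mod2pi_mod] and [mod2pi_unique]. *)
Definition mod2pi t : R :=
  t - 2 * pi * (Num.floor ((t + pi) / (2 * pi)))%:~R.

Definition mod2piv d (x : 'cV[R]_d) : 'cV[R]_d := map_mx mod2pi x.

Definition angles d : set 'cV[R]_d :=
  [set x | forall j, x j 0 \in `[- pi, pi[%R].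

(* A minimum, since it is attained: see [gdist_attained]. *)
Definition gdist s t : R :=
  inf [set `|t - s + 2 * pi * k%:~R| | k in [set: int]].

Definition dotp d (x y : 'cV[R]_d) : R := \sum_j x j 0 * y j 0.

Definition sqnorm2 d (x : 'cV[R]_d) : R := \sum_j x j 0 ^+ 2.

(* The multivalued $[t]_{2\pi}$, as the set of its allowed values. *)
Definition mmod2pi t : set R :=
  [set s | ((exists k : int, t = (2 * k + 1)%:~R * pi) /\ (s = pi \/ s = - pi))
        \/ (~ (exists k : int, t = (2 * k + 1)%:~R * pi) /\ s = mod2pi t)].

(* The values over which $d(x;w)$ is the minimum. *)
Definition cyclic_diff_values d (x w : 'cV[R]_d) : set R :=
  [set r | exists (a : R) (y : 'cV[R]_d),
     (forall j, mmod2pi (x j 0 + a) (y j 0)) /\ r = `|dotp y w|].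

(* A minimum when the entries of $w$ sum to 0: see [cyclic_diff_attained]. *)
Definition cyclic_diff d (x w : 'cV[R]_d) : R := inf (cyclic_diff_values x w).

Definition b1 : 'cV[R]_2 := \col_j [:: -1; 1]`_j.
Definition b2 : 'cV[R]_3 := \col_j [:: 1; -2; 1]`_j.
Definition b11 : 'cV[R]_4 := \col_j [:: -1; 1; 1; -1]`_j.

Variant stencil : forall d, 'cV[R]_d -> Prop :=
  | Stencil_b1 : stencil b1
  | Stencil_b2 : stencil b2
  | Stencil_b11 : stencil b11.

Definition energy (lam : R) d (f w x : 'cV[R]_d) : R :=
  \sum_j gdist (f j 0) (x j 0) ^+ 2 + lam * cyclic_diff x w ^+ 2.

Definition minimizers (T : Type) (D : set T) (E : T -> R) : set T :=
  [set x | D x /\ forall y, D y -> E x <= E y].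

Let pi2_gt0 : 0 < 2 * pi :> R. Proof. by rewrite mulr_gt0 ?pi_gt0. Qed.


Lemma mod2pi_itv t : mod2pi t \in `[- pi, pi[%R.
Proof.
rewrite /mod2pi; set q := (t + pi) / (2 * pi).
have tE : t = q * (2 * pi) - pi by rewrite /q divfK ?gt_eqF// addrK.
have /andP[h1 h2] := floor_itv q; rewrite intrD in h2.
have h3 : (Num.floor q)%:~R * (2 * pi) <= q * (2 * pi).
  by rewrite ler_pM2r.
have h4 : q * (2 * pi) < ((Num.floor q)%:~R + 1) * (2 * pi).
  by rewrite ltr_pM2r.
by clearbody q; rewrite in_itv/=; apply/andP; split; lra.
Qed.

Lemma mod2pi_mod t : exists k : int, t - mod2pi t = 2 * pi * k%:~R.
Proof. by exists (Num.floor ((t + pi) / (2 * pi))); rewrite /mod2pi subKr. Qed.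

Lemma dvd2pi_eq0 (k : int) : `|2 * pi * k%:~R| < 2 * pi :> R -> k = 0.
Proof.
rewrite normrM gtr0_norm// -[ltRHS]mulr1 ltr_pM2l// -intr_norm.
rewrite (_ : 1 = 1%:~R)// ltr_int; lia.
Qed.

Lemma mod2pi_unique t u (k : int) :
  u \in `[- pi, pi[%R -> t - u = 2 * pi * k%:~R -> u = mod2pi t.
Proof.
move=> + tu; have [l tl] := mod2pi_mod t; have := mod2pi_itv t.
rewrite !in_itv/= => /andP[? ?] /andP[? ?].
have e : mod2pi t - u = 2 * pi * (k - l)%:~R by rewrite intrB (mulrBr (2 * pi)); lra.
have : k - l = 0 by apply: dvd2pi_eq0; rewrite -e ltr_norml; apply/andP; split; lra.
by move=> kl; apply/eqP; rewrite eq_sym -subr_eq0 e kl mulr0.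
Qed.

Lemma inf_min (S : set R) r : S r -> lbound S r -> inf S = r.
Proof.
move=> Sr lr; apply/eqP; rewrite eq_le; apply/andP; split.
  by apply: ge_inf => //; exists r.
by apply: lb_le_inf => //; exists r.
Qed.

Lemma gdistE s t : gdist s t = `|mod2pi (t - s)|.
Proof.
have [l tl] := mod2pi_mod (t - s); apply: inf_min.
  by exists (- l) => //; congr `|_|; rewrite intrN mulrN -tl; ring.
move=> _ [k _ <-]; have := mod2pi_itv (t - s); rewrite in_itv/= => /andP[? ?].
have -> : t - s + 2 * pi * k%:~R = mod2pi (t - s) + 2 * pi * (k + l)%:~R.
  by rewrite intrD (mulrDr (2 * pi)) -tl; ring.
have [->|kl0] := eqVneq (k + l) 0; first by rewrite mulr0 addr0.
have : 2 * pi <= `|2 * pi * (k + l)%:~R : R|.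
  rewrite leNgt; apply/negP => /dvd2pi_eq0 /eqP; exact/negP.
have : `|mod2pi (t - s)| <= pi by rewrite ler_norml; apply/andP; split; lra.
have := ler_normB (mod2pi (t - s) + 2 * pi * (k + l)%:~R) (mod2pi (t - s)).
by set A := 2 * pi * (k + l)%:~R; rewrite (_ : mod2pi (t - s) + A - mod2pi (t - s) = A); lra.
Qed.

Lemma gdist_attained s t : exists k : int, gdist s t = `|t - s + 2 * pi * k%:~R|.
Proof.
have [l tl] := mod2pi_mod (t - s); exists (- l); rewrite gdistE.
by congr `|_|; rewrite intrN mulrN -tl; ring.
Qed.

Lemma mmod2pi_mod t s : mmod2pi t s ->
  `|s| <= pi /\ exists k : int, t - s = 2 * pi * k%:~R.
Proof.
have pi0 : 0 < pi :> R := pi_gt0 R.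
case=> [[[k ->] [->|->]]|[_ ->]].
- split; first by rewrite gtr0_norm.
  by exists k; rewrite intrD intrM; ring.
- split; first by rewrite normrN gtr0_norm.
  by exists (k + 1); rewrite !intrD intrM; ring.
split; last exact: mod2pi_mod.
have := mod2pi_itv t; rewrite in_itv/= ler_norml => /andP[-> h]; exact: ltW.
Qed.

Lemma mmod2pi_neq0 t : exists s, mmod2pi t s.
Proof.
have [H|H] := pselect (exists k : int, t = (2 * k + 1)%:~R * pi).
  by exists pi; left; split=> //; left.
by exists (mod2pi t); right.
Qed.

Lemma cyclic_diff_attained d (x w : 'cV[R]_d) : \sum_j w j 0 = 0 ->
  cyclic_diff_values x w (cyclic_diff x w).
Proof.
move=> w0; set S := cyclic_diff_values x w.
pose B := \sum_j `|x j 0|.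
pose N := `|Num.ceil ((B + 3 * pi) / (2 * pi))|%N.
pose F (c : {ffun 'I_d -> 'I_(2 * N).+1}) : R :=
  `|\sum_j (x j 0 - 2 * pi * ((c j)%:Z - N%:Z)%:~R) * w j 0|.
have SF r : S r -> exists c, F c = r.
  move=> [a [y [xy ->]]].
  have [k0 ak0] := mod2pi_mod a.
  have /choice[k kE] : forall j, exists k : int,
      x j 0 + a - y j 0 = 2 * pi * k%:~R.
    by move=> j; have [] := mmod2pi_mod (xy j).
  have kN j : `|k j - k0| <= N%:Z.
    have [yj _] := mmod2pi_mod (xy j).
    have xj : `|x j 0| <= B.
      by rewrite /B (bigD1 j)//= lerDl sumr_ge0.
    have e : 2 * pi * (k j - k0)%:~R = x j 0 - y j 0 + mod2pi a.
      by rewrite intrB (mulrBr (2 * pi)) -kE -ak0; lra.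
    have : `|2 * pi * (k j - k0)%:~R : R| <= B + 3 * pi.
      move: (mod2pi_itv a) xj yj; rewrite in_itv/= e !ler_norml.
      have := pi_gt0 R.
      by move=> ? /andP[? ?] /andP[? ?] /andP[? ?]; apply/andP; split; lra.
    rewrite normrM gtr0_norm// mulrC -ler_pdivlMr// => h.
    have := le_trans h (ceil_ge _); rewrite -intr_norm ler_int => h1; by rewrite /N abszE (le_trans h1)// ler_norm.
  have cP j : (`|(k j - k0 + N%:Z)%R|%N < (2 * N).+1)%N.
    by move: (kN j); clearbody N; lia.
  exists [ffun j => Ordinal (cP j)].
  rewrite /F /dotp; congr `|_|.
  have -> : \sum_j y j 0 * w j 0 =
      \sum_j ((y j 0 + (2 * pi * k0%:~R - a)) * w j 0).
    under [RHS]eq_bigr do rewrite mulrDl.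
    by rewrite big_split/= -mulr_sumr w0 mulr0 addr0.
  apply: eq_bigr => j _; rewrite ffunE/=; congr (_ * _).
  have -> : `|(k j - k0 + N%:Z)%R|%N%:Z - N%:Z = k j - k0.
    by move: (kN j); clear; clearbody N; lia.
  rewrite intrB (mulrBr (2 * pi)) -kE; lra.
have /choice[y yP] : forall j, exists s, mmod2pi (x j 0 + 0) s.
  by move=> j; exact: mmod2pi_neq0.
have S0 : S `|dotp (\col_j y j) w|.
  by exists 0, (\col_j y j); split=> // j; rewrite mxE; exact: yP.
have [c0 c0E] := SF _ S0.
pose P := [pred c | `[< S (F c) >]].
have Pc0 : P c0 by apply/asboolP; rewrite c0E.
have [c /asboolP Sc cmin] := @arg_minP _ _ _ c0 P F Pc0.
rewrite /cyclic_diff (inf_min Sc)// => r Sr.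
by have [c' c'r] := SF _ Sr; rewrite -c'r cmin//; apply/asboolP; rewrite c'r.
Qed.

Lemma stencil_sum0 d (w : 'cV[R]_d) : stencil w -> \sum_j w j 0 = 0.
Proof. by case; rewrite !big_ord_recr big_ord0 !mxE/=; lra. Qed.

End Cyclic.

(* Main.v *)
Require Import Defs.
From mathcomp Require Import all_boot all_order all_algebra.
From mathcomp Require Import boolp classical_sets reals trigo.
From mathcomp Require Import ring lra.

Set Implicit Arguments.
Unset Strict Implicit.
Unset Printing Implicit Defensive.

Import Order.TTheory GRing.Theory Num.Theory.
Local Open Scope classical_set_scope.
Local Open Scope ring_scope.

(** Everything rests on two facts: the cyclic difference is the wrapped ordinary
difference, and, once the angles are lifted to the real line, the energy is a
quadratic function whose square can be completed.

For the first fact ([cyclic_diffE]), let $y$ realize the minimum defining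
$d(x;w)$. Since $w$ is integral with sum zero, $\langle y,w\rangle$ is congruent
to $\langle x,w\rangle$ modulo $2\pi$, so it suffices that
$|\langle y,w\rangle|\le\pi$. Suppose $\langle y,w\rangle>\pi$. For the three
stencils, positivity of $\langle y,w\rangle$ forces some largest entry of $y$ to
have weight $1$, or some smallest one to have weight $-1$ ([stencil_unit_step]).
Rotate the circle until this entry sits at $\pm\pi$ and use the other
representative $\mp\pi$ for it: no other entry leaves $[-\pi,\pi]$, and the
difference drops by exactly $2\pi$ ([cyclic_diff_values_step]). Its modulus gets
smaller, against minimality. The case $\langle y,w\rangle<-\pi$ is the same
after a reflection of the circle.

For the second fact, write a point as $x=(f+z)_{2\pi}$ with $z$ the wrapped
displacement. Then $\mathcal E(x)=\|z\|^2+\lambda(M+\langle z,w\rangle)^2$ for some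
$M$ congruent to $\langle f,w\rangle$ ([energy_lift]), while for arbitrary $z$ and
every such $M$ the right-hand side is an upper bound ([energy_le]). With
$c=\lambda M/(1+\lambda\|w\|^2)$ it equals
$\lambda M^2/(1+\lambda\|w\|^2)+\|z+cw\|^2+\lambda\langle z+cw,w\rangle^2$
([complete_square]), so the minimizers are the points $(f-cw)_{2\pi}$ with $M$ of
least modulus in its class ([minimizers_energyE]). That $M$ is unique when
$|(\langle f,w\rangle)_{2\pi}|<\pi$ and is $\pm\pi$ otherwise. In the second case
the two points differ because $0<2c<2\pi$ when $M=\pi$, and $w$ has an entry
$1$. *)

(** * Congruence modulo $2\pi$ *)

Section Congruence.
Variable R : realType.
Implicit Types s t u v : R.

Definition eqm2pi s t := exists k : int, s - t = 2 * pi * k%:~R.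

Lemma eqm2pi_refl t : eqm2pi t t.
Proof. by exists 0; rewrite subrr mulr0. Qed.

Lemma eqm2pi_sym s t : eqm2pi s t -> eqm2pi t s.
Proof. by move=> [k e]; exists (- k); rewrite intrN; lra. Qed.

Lemma eqm2pi_trans t s u : eqm2pi s t -> eqm2pi t u -> eqm2pi s u.
Proof.
by move=> [k e] [l e']; exists (k + l); rewrite intrD (mulrDr (2 * pi)); lra.
Qed.

Lemma eqm2pi_add s t u v : eqm2pi s t -> eqm2pi u v -> eqm2pi (s + u) (t + v).
Proof.
by move=> [k e] [l e']; exists (k + l); rewrite intrD (mulrDr (2 * pi)); lra.
Qed.

Lemma eqm2pi_opp s t : eqm2pi s t -> eqm2pi (- s) (- t).
Proof. by move=> [k e]; exists (- k); rewrite intrN; lra. Qed.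

Lemma eqm2pi_mulz s t (n : int) :
  eqm2pi s t -> eqm2pi (s * n%:~R) (t * n%:~R).
Proof. by move=> [k e]; exists (k * n); rewrite intrM -mulrBl e; ring. Qed.

Lemma eqm2pi_mod t : eqm2pi t (mod2pi t).
Proof. exact: mod2pi_mod. Qed.

Lemma eqm2pi_mod2pi s t : eqm2pi s t -> mod2pi s = mod2pi t.
Proof.
move=> st; have [k e] : eqm2pi t (mod2pi s).
  exact: eqm2pi_trans (eqm2pi_sym st) (eqm2pi_mod s).
exact: mod2pi_unique (mod2pi_itv s) e.
Qed.

Lemma norm_mod2pi_le t u : eqm2pi t u -> `|mod2pi t| <= `|u|.
Proof.
move=> [k e]; rewrite -[t]subr0 -gdistE; apply: ge_inf.
  by exists 0 => _ [l _ <-].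
by exists (- k) => //; congr `|_|; rewrite intrN; lra.
Qed.

(** The wrapped value is pinned down only up to sign here: for [u = pi] it is
[- pi]. *)
Lemma norm_mod2pi_eq t u : eqm2pi t u -> `|u| <= pi -> `|mod2pi t| = `|u|.
Proof.
move=> tu; rewrite ler_norml => /andP[u1]; rewrite le_eqVlt => /orP[/eqP u2|u2].
  have [k e] : eqm2pi t (- pi).
    apply: eqm2pi_trans tu _; rewrite u2; exists 1; rewrite mulr1; ring.
  have <- : - pi = mod2pi t.
    apply: mod2pi_unique e; rewrite in_itv/= lexx/=.
    by have := pi_gt0 R; lra.
  by rewrite u2 normrN.
by have [k e] := tu; rewrite -(mod2pi_unique _ e)// in_itv/= u1 u2.
Qed.

(** The multivalued wrapping in a form free of case distinctions, which is stable
under rotations and reflections of the circle. *)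
Lemma mmod2piE t s : mmod2pi t s <-> `|s| <= pi /\ eqm2pi t s.
Proof.
split=> [/mmod2pi_mod//|[sp ts]].
have [[n tn]|H] := pselect (exists k : int, t = (2 * k + 1)%:~R * pi); last first.
  right; split=> //; have [k e] := ts; apply: mod2pi_unique (e).
  move: sp; rewrite ler_norml in_itv/= => /andP[-> ]; rewrite le_eqVlt.
  move=> /orP[/eqP sp|//]; exfalso; apply: H; exists k.
  by rewrite intrD intrM; lra.
left; split; first by exists n.
have tpi : eqm2pi t pi by exists n; rewrite tn intrD intrM; ring.
have pi0 := pi_gt0 R.
have : `|s| = pi.
  rewrite -(norm_mod2pi_eq ts sp) (norm_mod2pi_eq tpi) gtr0_norm//.
have [s0|s0] := leP 0 s; first by rewrite ger0_norm// => ->; left.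
by rewrite ltr0_norm// => <-; right; rewrite opprK.
Qed.

End Congruence.

(** * The cyclic difference as a wrapped difference *)

Section CyclicDifference.
Variables (R : realType) (d : nat).
Implicit Types x y z w f : 'cV[R]_d.

Lemma dotpDl x y w : dotp (x + y) w = dotp x w + dotp y w.
Proof. by rewrite /dotp -big_split; apply: eq_bigr => j _; rewrite mxE mulrDl. Qed.

Lemma dotpZl (c : R) x w : dotp (c *: x) w = c * dotp x w.
Proof. by rewrite /dotp mulr_sumr; apply: eq_bigr => j _; rewrite mxE mulrA. Qed.

Lemma dotpNl x w : dotp (- x) w = - dotp x w.
Proof. by rewrite -scaleN1r dotpZl mulN1r. Qed.

Lemma dotpv w : dotp w w = sqnorm2 w.
Proof. by apply: eq_bigr => j _; rewrite expr2. Qed.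

Lemma eqm2pi_dotp x y w : (forall j, exists n : int, w j 0 = n%:~R) ->
  (forall j, eqm2pi (x j 0) (y j 0)) -> eqm2pi (dotp x w) (dotp y w).
Proof.
move=> wZ xy; rewrite /dotp; elim/big_ind2: _.
- exact: eqm2pi_refl.
- by move=> *; exact: eqm2pi_add.
- by move=> j _; have [n ->] := wZ j; exact: eqm2pi_mulz.
Qed.

Lemma cyclic_diff_valuesP x w (r : R) : cyclic_diff_values x w r <->
  exists a y, (forall j, `|y j 0| <= pi /\ eqm2pi (x j 0 + a) (y j 0)) /\
    r = `|dotp y w|.
Proof.
by split=> -[a [y [xy ->]]]; exists a, y; split=> // j; apply/mmod2piE.
Qed.

Lemma cyclic_diff_valuesN x w (r : R) :
  cyclic_diff_values x w r -> cyclic_diff_values (- x) w r.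
Proof.
move=> /cyclic_diff_valuesP[a [y [xy ->]]].
apply/cyclic_diff_valuesP; exists (- a), (- y); split; last first.
  by rewrite dotpNl normrN.
move=> j; have [yj e] := xy j; rewrite !mxE normrN -opprD; split=> //.
exact: eqm2pi_opp.
Qed.

(** The condition under which a positive difference can be lowered by exactly one
turn: the entry [j] is a maximum of [y] if its weight is 1, a minimum if its
weight is -1, and in both cases it is the first one to cross the cut point when
the circle is rotated in the direction of [w j 0]. *)
Definition unit_step w := forall y, 0 < dotp y w ->
  exists2 j, `|w j 0| = 1 & forall i, w j 0 * y i 0 <= w j 0 * y j 0.

(** Rotating by [c] brings the entry [j] to [w j 0 * pi], and extremality keeps all
other entries in [[- pi, pi]]. Replacing the entry by its opposite
representative [- w j 0 * pi] changes the difference by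
[- 2 * pi * w j 0 ^+ 2 = - 2 * pi]. *)
Lemma cyclic_diff_values_step x y w (a : R) :
  \sum_j w j 0 = 0 -> unit_step w ->
  (forall j, `|y j 0| <= pi /\ eqm2pi (x j 0 + a) (y j 0)) ->
  0 < dotp y w -> cyclic_diff_values x w `|dotp y w - 2 * pi|.
Proof.
move=> w0 wU xy /wU[j wj1 jmax].
have {}wj1 : w j 0 = 1 \/ w j 0 = -1.
  by case: (ger0P (w j 0)) wj1 => _; lra.
set e := w j 0 in wj1 jmax.
pose c := e * pi - y j 0.
apply/cyclic_diff_valuesP; exists (a + c).
exists (\col_i (y i 0 + c - (if i == j then 2 * pi * e else 0))); split.
  move=> i; rewrite mxE; split.
    have := pi_gt0 R; have [+ _] := xy i; have [+ _] := xy j; have := jmax i.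
    rewrite !ler_norml /c => h /andP[? ?] /andP[? ?] ?.
    have [-> {h}|_] := eqVneq i j.
      by case: wj1 => ->; apply/andP; split; lra.
    by move: h; case: wj1 => -> h; apply/andP; split; lra.
  rewrite -[x i 0 + (a + c)]addr0 addrA; apply: eqm2pi_add.
    by apply: eqm2pi_add; [have [] := xy i | exact: eqm2pi_refl].
  case: eqP => _; last by rewrite oppr0; exact: eqm2pi_refl.
  by case: wj1 => ->; [exists 1|exists (-1)]; rewrite ?intrN; lra.
congr `|_|; rewrite /dotp.
under [RHS]eq_bigr => i _ do rewrite mxE mulrBl mulrDl.
rewrite sumrB big_split/= -mulr_sumr w0 mulr0 addr0; congr (_ - _).
rewrite (bigD1 j)//= eqxx big1 ?addr0 => [|i /negPf->]; last by rewrite mul0r.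
by rewrite -/e; case: wj1 => ->; lra.
Qed.

(** A configuration [y] that realizes the minimum cannot have a difference of
modulus above [pi], since one step would then lower it; below that bound the
modulus is determined by the congruence class. *)
Lemma cyclic_diffE x w : \sum_j w j 0 = 0 ->
  (forall j, exists n : int, w j 0 = n%:~R) -> unit_step w ->
  cyclic_diff x w = `|mod2pi (dotp x w)|.
Proof.
move=> w0 wZ wU.
have /cyclic_diff_valuesP[a [y [xy E]]] := cyclic_diff_attained x w0.
have xyw : eqm2pi (dotp x w) (dotp y w).
  have -> : dotp x w = dotp (x + const_mx a) w.
    rewrite dotpDl [X in _ + X](_ : _ = 0) ?addr0// /dotp.
    by under eq_bigr do rewrite mxE; rewrite -mulr_sumr w0 mulr0.
  by apply: eqm2pi_dotp => // j; rewrite !mxE; have [] := xy j.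
rewrite E (norm_mod2pi_eq xyw)//; rewrite leNgt; apply/negP => big.
have least r : cyclic_diff_values x w r -> `|dotp y w| <= r.
  move=> xr; rewrite -E; apply: ge_inf => //.
  by exists 0 => _ [b [z [_ ->]]].
have pi0 := pi_gt0 R.
have [y0|y0] := leP (dotp y w) 0; last first.
  have := least _ (cyclic_diff_values_step w0 wU xy y0).
  move: big; rewrite (gtr0_norm y0) => big.
  by rewrite leNgt => /negP; apply; rewrite ltr_norml; apply/andP; split; lra.
(* A negative difference is increased by stepping in the reflected circle. *)
have y0' : 0 < dotp (- y) w by move: big; rewrite dotpNl ler0_norm//; lra.
have xyN j : `|(- y) j 0| <= pi /\ eqm2pi ((- x) j 0 + - a) ((- y) j 0).
  by have [? ?] := xy j; rewrite !mxE normrN -opprD; split=> //; exact: eqm2pi_opp.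
have := cyclic_diff_valuesN (cyclic_diff_values_step w0 wU xyN y0').
rewrite opprK => /least; move: big; rewrite dotpNl ler0_norm// => big.
by rewrite leNgt => /negP; apply; rewrite ltr_norml; apply/andP; split; lra.
Qed.

End CyclicDifference.

(** * The three stencils *)

Section Stencils.
Variable R : realType.

Lemma forall_ordS n (P : 'I_n.+1 -> Prop) :
  P ord0 -> (forall i, P (lift ord0 i)) -> forall i, P i.
Proof. by move=> P0 PS i; case: (unliftP ord0 i) => [j|] ->. Qed.

Lemma forall_ord0 (P : 'I_0 -> Prop) : forall i, P i.
Proof. by case. Qed.

Lemma stencil_int d (w : 'cV[R]_d) : stencil w ->
  forall j, exists n : int, w j 0 = n%:~R.
Proof.
case=> j; rewrite mxE.
- by exists [:: -1; 1]`_j; case: j => [[|[|]]].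
- by exists [:: 1; -2; 1]`_j; case: j => [[|[|[|]]]].
- by exists [:: -1; 1; 1; -1]`_j; case: j => [[|[|[|[|]]]]].
Qed.

Lemma stencil_entry1 d (w : 'cV[R]_d) : stencil w -> exists j, w j 0 = 1.
Proof.
case.
- by exists (Ordinal (isT : 1 < 2)%N); rewrite mxE.
- by exists (Ordinal (isT : 0 < 3)%N); rewrite mxE.
- by exists (Ordinal (isT : 1 < 4)%N); rewrite mxE.
Qed.

(** For instance, if [y0 <= y3] and [y1 < y0], then the sum inequality gives
[y2 > y3 + (y0 - y1) > y3], so [y2] is the largest. *)
Lemma extremal_of_balanced (y0 y1 y2 y3 : R) : y0 + y3 < y1 + y2 ->
  [\/ [/\ y0 <= y1, y2 <= y1 & y3 <= y1], [/\ y0 <= y2, y1 <= y2 & y3 <= y2],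
      [/\ y0 <= y1, y0 <= y2 & y0 <= y3] | [/\ y3 <= y0, y3 <= y1 & y3 <= y2]].
Proof.
move=> y_lt; have [?|?] := leP y0 y3.
  have [?|?] := leP y0 y1; last by constructor 2; split; lra.
  have [?|?] := leP y0 y2; last by constructor 1; split; lra.
  by constructor 3; split.
have [?|?] := leP y3 y1; last by constructor 2; split; lra.
have [?|?] := leP y3 y2; last by constructor 1; split; lra.
by constructor 4; split; lra.
Qed.

(** For the second difference, [2 * y1 < y0 + y2] makes the larger of [y0] and [y2],
both of weight 1, the maximum; the other two stencils have weights 1 and -1
only. *)
Lemma stencil_unit_step d (w : 'cV[R]_d) : stencil w -> unit_step w.
Proof.
case=> y; rewrite /dotp !big_ord_recl big_ord0 !mxE/= => y_gt0.
- exists (lift ord0 ord0); first by rewrite mxE/= normr1.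
  by do 2?apply: forall_ordS; try exact: forall_ord0; rewrite !mxE/=; lra.
- have [y20|y02] := leP (y (lift ord0 (lift ord0 ord0)) 0) (y ord0 0).
  + exists ord0; first by rewrite mxE/= normr1.
    by do 3?apply: forall_ordS; try exact: forall_ord0; rewrite !mxE/=; lra.
  + exists (lift ord0 (lift ord0 ord0)); first by rewrite mxE/= normr1.
    by do 3?apply: forall_ordS; try exact: forall_ord0; rewrite !mxE/=; lra.
have [|[? ? ?]|[? ? ?]|[? ? ?]|[? ? ?]] := extremal_of_balanced (y0 := y ord0 0)
  (y1 := y (lift ord0 ord0) 0) (y2 := y (lift ord0 (lift ord0 ord0)) 0)
  (y3 := y (lift ord0 (lift ord0 (lift ord0 ord0))) 0); first by lra.
- exists (lift ord0 ord0); first by rewrite mxE/= normr1.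
  by do 4?apply: forall_ordS; try exact: forall_ord0; rewrite !mxE/=; lra.
- exists (lift ord0 (lift ord0 ord0)); first by rewrite mxE/= normr1.
  by do 4?apply: forall_ordS; try exact: forall_ord0; rewrite !mxE/=; lra.
- exists ord0; first by rewrite mxE/= normrN1.
  by do 4?apply: forall_ordS; try exact: forall_ord0; rewrite !mxE/=; lra.
- exists (lift ord0 (lift ord0 (lift ord0 ord0))); first by rewrite mxE/= normrN1.
  by do 4?apply: forall_ordS; try exact: forall_ord0; rewrite !mxE/=; lra.
Qed.

End Stencils.

(** * Minimizing the energy *)

Section Energy.
Variables (R : realType) (d : nat).
Implicit Types x y z w f : 'cV[R]_d.

Lemma complete_square (lam M : R) w z : 0 < 1 + lam * sqnorm2 w ->
  let c := lam * M / (1 + lam * sqnorm2 w) in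
  sqnorm2 z + lam * (M + dotp z w) ^+ 2 =
  lam * M ^+ 2 / (1 + lam * sqnorm2 w)
   + (sqnorm2 (z + c *: w) + lam * dotp (z + c *: w) w ^+ 2).
Proof.
move=> D0 c.
have -> : sqnorm2 (z + c *: w) = sqnorm2 z + 2 * c * dotp z w + c ^+ 2 * sqnorm2 w.
  rewrite /sqnorm2 /dotp !mulr_sumr -!big_split; apply: eq_bigr => j _ /=.
  by rewrite !mxE; ring.
rewrite dotpDl dotpZl dotpv /c.
move: (sqnorm2 w) (dotp z w) D0 => N p D0.
by field; rewrite gt_eqF.
Qed.

Lemma sqnorm2_ge0 z : 0 <= sqnorm2 z.
Proof. by apply: sumr_ge0 => j _; exact: sqr_ge0. Qed.

Lemma sqnorm2_eq0 z : sqnorm2 z = 0 -> z = 0.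
Proof.
move=> /eqP; rewrite /sqnorm2 psumr_eq0 => [|j _]; last exact: sqr_ge0.
move=> /allP z0; apply/colP => j; rewrite mxE; apply/eqP.
by rewrite -(sqrf_eq0 (z j 0)); exact: z0 (mem_index_enum j).
Qed.

Lemma mod2piv_angles x : angles (mod2piv x).
Proof. by move=> j; rewrite mxE; exact: mod2pi_itv. Qed.

Lemma mod2piv_eq x y : (forall j, eqm2pi (x j 0) (y j 0)) ->
  mod2piv x = mod2piv y.
Proof. by move=> xy; apply/colP => j; rewrite !mxE; exact: eqm2pi_mod2pi. Qed.

Lemma mod2piv_id x : angles x -> mod2piv x = x.
Proof.
move=> xA; apply/colP => j; rewrite mxE; have [k e] := eqm2pi_refl (x j 0).
by rewrite -(mod2pi_unique (xA j) e).
Qed.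

Section Minimizers.
Variables (lam : R) (f w : 'cV[R]_d).
Hypothesis lam_gt0 : 0 < lam.
Hypothesis wZ : forall j, exists n : int, w j 0 = n%:~R.
Hypothesis cyclic_diffw : forall x, cyclic_diff x w = `|mod2pi (dotp x w)|.

Let N := sqnorm2 w.
Let m := mod2pi (dotp f w).

(** The inequality holds for displacements [z] of any size, because wrapping never
increases the modulus within a congruence class. *)
Lemma energy_le z (M : R) : eqm2pi (dotp f w) M ->
  energy lam f w (mod2piv (f + z)) <= sqnorm2 z + lam * (M + dotp z w) ^+ 2.
Proof.
move=> fM; rewrite /energy cyclic_diffw; apply: lerD.
  apply: ler_sum => j _; rewrite gdistE -[leRHS]real_normK ?num_real// ler_sqr ?nnegrE//.
  apply: norm_mod2pi_le; rewrite !mxE.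
  have := eqm2pi_add (eqm2pi_sym (eqm2pi_mod (f j 0 + z j 0))) (eqm2pi_refl (- f j 0)).
  by rewrite (_ : f j 0 + z j 0 - f j 0 = z j 0)//; ring.
rewrite ler_pM2l// -[leRHS]real_normK ?num_real// ler_sqr ?nnegrE//.
apply: norm_mod2pi_le; apply: (@eqm2pi_trans _ (dotp (f + z) w)).
  apply: eqm2pi_dotp => // j; rewrite mxE; exact/eqm2pi_sym/eqm2pi_mod.
by rewrite dotpDl; apply: eqm2pi_add => //; exact: eqm2pi_refl.
Qed.

(** The shortest displacement [z] from [f] to [x] computes the data term exactly,
and [M] absorbs the number of turns needed to make the other term exact too. *)
Lemma energy_lift x : angles x -> exists z (M : R),
  [/\ eqm2pi (dotp f w) M, x = mod2piv (f + z) &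
      energy lam f w x = sqnorm2 z + lam * (M + dotp z w) ^+ 2].
Proof.
move=> xA; pose z := mod2piv (x - f).
have xfz j : eqm2pi (x j 0) ((f + z) j 0).
  rewrite !mxE; have := eqm2pi_add (eqm2pi_refl (f j 0)) (eqm2pi_mod (x j 0 - f j 0)).
  by rewrite (_ : f j 0 + (x j 0 - f j 0) = x j 0)//; ring.
exists z, (mod2pi (dotp x w) - dotp z w); split.
- have := eqm2pi_dotp wZ xfz; rewrite dotpDl => xw.
  have := eqm2pi_add (eqm2pi_trans (eqm2pi_sym xw) (eqm2pi_mod _)) (eqm2pi_refl (- dotp z w)).
  by rewrite addrK.
- by rewrite -(mod2piv_eq xfz) mod2piv_id.
- rewrite /energy cyclic_diffw real_normK ?num_real// subrK; congr (_ + _).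
  by apply: eq_bigr => j _; rewrite gdistE real_normK ?num_real// !mxE.
Qed.

(** By completing the square, the minimum is [lam * M ^+ 2 / (1 + lam * N)] for the
representatives [M] of least modulus; equality forces [M] to be one of those and
the completed square to vanish, which determines the displacement. *)
Lemma minimizers_energyE :
  minimizers (@angles R d) (energy lam f w) =
  [set mod2piv (f - (lam * M / (1 + lam * N)) *: w) |
    M in [set M | eqm2pi (dotp f w) M /\ `|M| = `|m|]].
Proof.
have D0 : 0 < 1 + lam * N by rewrite ltr_pwDl// mulr_ge0 ?sqnorm2_ge0 ?ltW.
have sq_le (M M' : R) :
    (lam * M ^+ 2 / (1 + lam * N) <= lam * M' ^+ 2 / (1 + lam * N)) = (`|M| <= `|M'|).
  rewrite ler_pM2r ?invr_gt0// ler_pM2l// -[RHS]ler_sqr ?nnegrE//.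
  by rewrite !real_normK ?num_real.
have energy_shift (M : R) : eqm2pi (dotp f w) M ->
    energy lam f w (mod2piv (f - (lam * M / (1 + lam * N)) *: w))
      <= lam * M ^+ 2 / (1 + lam * N).
  move=> fM; apply: le_trans (energy_le _ fM) _.
  rewrite complete_square// addNr.
  have -> : sqnorm2 (0 : 'cV[R]_d) = 0.
    by rewrite /sqnorm2 big1// => j _; rewrite mxE expr0n.
  have -> : dotp (0 : 'cV[R]_d) w = 0.
    by rewrite /dotp big1// => j _; rewrite mxE mul0r.
  by rewrite expr0n/= mulr0 !addr0.
apply/seteqP; split=> [x [xA xmin]|_ [M [fM Mm] <-]].
  have [z [M [fM xz xE]]] := energy_lift xA.
  have := le_trans (xmin _ (mod2piv_angles _)) (energy_shift _ (eqm2pi_mod _)).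
  rewrite xE complete_square// -/N -/m; set c := lam * M / _; set q := sqnorm2 _ + _ => h.
  have q1 : sqnorm2 (z + c *: w) <= q by rewrite lerDl mulr_ge0 ?sqr_ge0// ltW.
  have mM : `|m| <= `|M| by exact: norm_mod2pi_le.
  have zc0 := sqnorm2_ge0 (z + c *: w).
  have Mm : `|M| = `|m|.
    by apply/eqP; rewrite eq_le mM andbT; rewrite -sq_le; lra.
  exists M => //; rewrite xz; congr (mod2piv (_ + _)).
  have /eqP : z + c *: w = 0.
    by apply: sqnorm2_eq0; move: mM; rewrite -sq_le; lra.
  by rewrite addr_eq0 => /eqP.
split; first exact: mod2piv_angles.
move=> y /energy_lift[z [M' [fM' _ ->]]].
apply: le_trans (energy_shift _ fM) _; rewrite complete_square// -/N.
apply: ler_wpDr.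
  by rewrite addr_ge0 ?sqnorm2_ge0// mulr_ge0 ?sqr_ge0// ltW.
by rewrite sq_le Mm; exact: norm_mod2pi_le.
Qed.

End Minimizers.

End Energy.

(** * Representatives of least modulus *)

Section LeastRepresentatives.
Variable R : realType.
Implicit Types t M : R.

Lemma least_repr_lt t : `|mod2pi t| < pi ->
  [set M | eqm2pi t M /\ `|M| = `|mod2pi t|] = [set mod2pi t].
Proof.
move=> tpi; apply/seteqP; split=> [M [[k e] Mt]|_ ->]; last first.
  by split => //; exact: eqm2pi_mod.
apply: mod2pi_unique e; move: tpi; rewrite -Mt in_itv/= ltr_norml.
by move=> /andP[/ltW -> ->].
Qed.

Lemma least_repr_pi t : `|mod2pi t| = pi ->
  [set M | eqm2pi t M /\ `|M| = `|mod2pi t|] = [set pi; - pi].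
Proof.
move=> tpi; have pi0 := pi_gt0 R.
have tE : mod2pi t = - pi.
  have := mod2pi_itv t; rewrite in_itv/= => /andP[_ lt_pi].
  have [t0|t0] := leP 0 (mod2pi t); last by rewrite -tpi ltr0_norm ?opprK.
  by move: lt_pi; rewrite -[X in X < _](ger0_norm t0) tpi ltxx.
have tN : eqm2pi t (- pi) by rewrite -tE; exact: eqm2pi_mod.
apply/seteqP; split=> [M [_]|M]; rewrite tpi.
  have [M0|M0] := leP 0 M; first by rewrite ger0_norm// => ->; left.
  by rewrite ltr0_norm// => <-; right; rewrite /= opprK.
case=> ->; split=> //; rewrite ?normrN ?gtr0_norm//.
by apply: eqm2pi_trans tN _; exists (-1); rewrite intrN; lra.
Qed.

End LeastRepresentatives.

Theorem theorem3p6 (R : realType) (d : nat) (w f : 'cV[R]_d) (lam : R)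
    (hw : stencil w) (hlam : 0 < lam) (hf : angles f) :
  (`|mod2pi (dotp f w)| < pi ->
    minimizers (@angles R d) (energy lam f w) =
    [set mod2piv (f - (lam * mod2pi (dotp f w) / (1 + lam * sqnorm2 w)) *: w)])
  /\
  (`|mod2pi (dotp f w)| = pi ->
    let xm := mod2piv (f - (lam * pi / (1 + lam * sqnorm2 w)) *: w) in
    let xp := mod2piv (f + (lam * pi / (1 + lam * sqnorm2 w)) *: w) in
    xm <> xp /\ minimizers (@angles R d) (energy lam f w) = [set xm; xp]).
Proof.
have wZ := stencil_int hw.
have wE x : cyclic_diff x w = `|mod2pi (dotp x w)|.
  by apply: cyclic_diffE => //; [exact: stencil_sum0|exact: stencil_unit_step].
split=> [mpi|mpi xm xp]; rewrite minimizers_energyE//.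
  by rewrite least_repr_lt// image_set1.
rewrite least_repr_pi// image_setU !image_set1; split; last first.
  by rewrite mulrN mulNr scaleNr opprK.
have [j wj] := stencil_entry1 hw.
have N1 : 1 <= sqnorm2 w.
  rewrite /sqnorm2 (bigD1 j)//= wj expr1n lerDl sumr_ge0// => i _.
  exact: sqr_ge0.
move=> /colP/(_ j); rewrite !mxE wj !mulr1.
set c := lam * pi / _ => e.
have pi0 := pi_gt0 R.
have D0 : 0 < 1 + lam * sqnorm2 w by rewrite ltr_pwDl// mulr_ge0 ?ltW//; lra.
have c0 : 0 < c by rewrite divr_gt0// mulr_gt0.
have c_lt_pi : c < pi.
  by rewrite ltr_pdivrMr// mulrC ltr_pM2l//; nra.
(* If the two points agreed in entry [j], then [2 * c], which lies strictly
   between 0 and [2 * pi], would be a multiple of [2 * pi]. *)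
have [k ck] : eqm2pi (f j 0 + c) (f j 0 - c).
  by apply: eqm2pi_trans (eqm2pi_mod _) _; rewrite -e; exact/eqm2pi_sym/eqm2pi_mod.
have ck2 : 2 * c = 2 * pi * k%:~R by rewrite -ck; ring.
have k0 : k = 0.
  by apply: (@dvd2pi_eq0 R); rewrite -ck2 gtr0_norm; lra.
by move: ck2; rewrite k0 mulr0; lra.
Qed.
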